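(* Let $G$ be a finite group. If $G$ contains elements $x$ and $y$ of coprime orders such that $xy=yx$, $\langle x\rangle$ is not normal in $C_G(y)$, and $\langle y\rangle$ is not normal in $C_G(x)$, then the power graph $\mathrm{Pow}(G)$ is non-chordal.
   Context: The power graph $\mathrm{Pow}(G)$ of a group $G$ is the simple graph with vertex set $G$ in which two distinct elements $x,y$ are joined by an edge if and only if $x^m=y$ or $y^m=x$ for some $m\in\mathbb{N}$. A graph is chordal if it has no induced cycle on at least four vertices. *)

(* Defs.v *)
From mathcomp Require Import all_boot all_fingroup.

Set Implicit Arguments.
Unset Strict Implicit.
Unset Printing Implicit Defensive.

Record sgraph := SGraph {
  vertex : Type;
  adj : vertex -> vertex -> Prop;
  adj_sym : forall u v, adj u v -> adj v u;
  adj_irrefl : forall u, ~ adj u u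
}.

(* [ordS i] is the successor of [i] modulo [n]; the "iff" makes the cycle
   induced.  The definition describes an n-cycle only for n >= 3. *)
Definition induced_cycle (S : sgraph) (n : nat) (c : 'I_n -> vertex S) : Prop :=
  injective c /\
  forall i j : 'I_n, adj (c i) (c j) <-> (j = ordS i \/ i = ordS j).

Definition chordal (S : sgraph) : Prop :=
  forall (n : nat) (c : 'I_n -> vertex S), 4 <= n -> ~ induced_cycle c.

Section PowerGraph.

Local Open Scope group_scope.

Variables (gT : finGroupType) (G : {group gT}).

Definition pow_adj (x y : subg_of G) : Prop :=
  x <> y /\ ((exists m : nat, x ^+ m = y) \/ (exists m : nat, y ^+ m = x)).

Lemma pow_adj_sym (x y : subg_of G) : pow_adj x y -> pow_adj y x.
Proof. by case=> nxy [h|h]; split; [move/esym|right|move/esym|left]. Qed.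

Lemma pow_adj_irrefl (x : subg_of G) : ~ pow_adj x x.
Proof. by case. Qed.

Definition Pow : sgraph := SGraph pow_adj_sym pow_adj_irrefl.

End PowerGraph.

(* Main.v *)
Require Import Defs.
From mathcomp Require Import all_boot all_fingroup.
From mathcomp Require Import cyclic.
From mathcomp Require Import zify.

(** Call a and b linked when, in one order or the other, they are the images of
    x and y under conjugation by the same element of G.  Linked elements commute
    and have coprime orders, so <[a * b]> contains <[a]> and <[b]> as its only
    subgroups of these orders; hence a, a * b, b is a path of the power graph.
    By hypothesis some g in G fixes y by conjugation and moves <[x]>, and some h
    in G fixes x and moves <[y]>: in a linked pair either member can be replaced
    by one that generates another subgroup.  Replacing them alternately yields an
    infinite walk v 0 = x, v 1 = y, v 2, ... whose consecutive terms are linked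
    and for which <[v k]> and <[v k.+2]> always differ (nonbacktracking_walk).

    As the group is finite, the subgroups <[v k]> must repeat; the part of the
    walk up to the first repetition is a closed circuit (first_repetition), of
    length at least 3 because it neither stalls nor backtracks.  Inserting the
    product v k * v k.+1 between consecutive terms turns it into a cycle of the
    power graph of twice the length.  This cycle is always induced: a vertex is
    a power of another one only if the corresponding inclusion of cyclic
    subgroups holds, and by uniqueness of subgroups of given order in a cyclic
    group (mem_cycle_mul) the only such inclusions are those of consecutive
    vertices (mem_subdivision). *)

Set Implicit Arguments.
Unset Strict Implicit.
Unset Printing Implicit Defensive.

Local Open Scope group_scope.

(** * Powers in products of commuting elements of coprime orders *)

Lemma cycle_mul_mem (gT : finGroupType) (a b : gT) (H : {group gT}) :
  commute a b -> coprime #[a] #[b] ->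
  (a * b \in H) = (a \in H) && (b \in H).
Proof.
move=> cab co; apply/idP/andP => [abH | [aH bH]]; last exact: groupM.
have sabH : <[a]> * <[b]> \subset H by rewrite -cycleM // cycle_subG.
split; apply: (subsetP sabH).
  by rewrite -{1}[a]mulg1 mem_mulg ?cycle_id ?group1.
by rewrite -{1}[b]mul1g mem_mulg ?cycle_id ?group1.
Qed.

(** A cyclic group has one subgroup of each order, and <[a]> is a subgroup of
    <[a * b]>. *)
Lemma mem_cycle_mul (gT : finGroupType) (a b z : gT) :
  commute a b -> coprime #[a] #[b] -> #[z] = #[a] ->
  (z \in <[a * b]>) = (<[z]> == <[a]>).
Proof.
move=> cab co ozA.
have: a * b \in <[a * b]> by exact: cycle_id.
rewrite cycle_mul_mem // => /andP[aab _].
apply/idP/eqP => [zab | eza]; last first.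
  by rewrite -cycle_subG eza cycle_subG.
apply/eqP; rewrite (eq_subG_cyclic (cycle_cyclic (a * b))) ?cycle_subG //.
by rewrite -!orderE ozA.
Qed.

(** * Alternating walks *)

Definition alternating (gT : finGroupType) (u : nat -> gT) :=
  forall k, [/\ commute (u k) (u k.+1), coprime #[u k] #[u k.+1],
                1 < #[u k] & #[u k.+2] = #[u k]].

Lemma alternating_shift (gT : finGroupType) (u : nat -> gT) i :
  alternating u -> alternating (fun k => u (i + k)).
Proof. by move=> altu k; rewrite !addnS; apply: altu. Qed.

Lemma alternating_order (gT : finGroupType) (u : nat -> gT) k :
  alternating u -> #[u k] = #[u (odd k)].
Proof.
move=> altu; have [n] := ubnP k; elim: n k => // n IHn [|[|k]] //= lekn.
by have [_ _ _ ->] := altu k; rewrite negbK IHn // ltnW.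
Qed.

Lemma alternating_coprime (gT : finGroupType) (u : nat -> gT) k l :
  alternating u -> odd k != odd l -> coprime #[u k] #[u l].
Proof.
move=> altu; rewrite (alternating_order k) // (alternating_order l) //.
have [_ co _ _] := altu 0.
by case: (odd k) (odd l) => [] [] //; rewrite coprime_sym.
Qed.

Lemma alternating_dvd_odd (gT : finGroupType) (u : nat -> gT) k l :
  alternating u -> #[u k] %| #[u l] -> odd k = odd l.
Proof.
move=> altu dvd_kl; apply/eqP; apply: contraT => /(alternating_coprime altu).
have [_ _ gt1 _] := altu k.
by rewrite /coprime (gcdn_idPl dvd_kl) => /eqP o1; rewrite o1 in gt1.
Qed.

(** Only terms of the same parity can be comparable, and these have equal
    orders, so comparable cyclic subgroups are equal. *)
Lemma alternating_mem (gT : finGroupType) (u : nat -> gT) k l :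
  alternating u -> (u k \in <[u l]>) = (<[u k]> == <[u l]>).
Proof.
move=> altu; apply/idP/eqP => [kl | <-]; last exact: cycle_id.
have /(alternating_dvd_odd altu) odd_kl := order_dvdG kl.
apply/eqP; rewrite eqEcard cycle_subG kl -!orderE.
by rewrite (alternating_order k) // (alternating_order l) // odd_kl leqnn.
Qed.

(** The parity of k decides which factor has the order of u k, so that the
    uniqueness of subgroups of that order applies to this factor. *)
Lemma alternating_mem_mul (gT : finGroupType) (u : nat -> gT) k l :
  alternating u ->
  (u k \in <[u l * u l.+1]>) = (<[u k]> == <[u l]>) || (<[u k]> == <[u l.+1]>).
Proof.
move=> altu; have [cl col _ _] := altu l.
have neq p q : odd p != odd q -> (<[u p]> == <[u q]>) = false.
  move=> npq; apply: contraNF npq => /eqP epq; apply/eqP.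
  by apply: (alternating_dvd_odd altu); rewrite !orderE epq.
have [okl | nokl] := eqVneq (odd k) (odd l).
  rewrite mem_cycle_mul //; last first.
    by rewrite (alternating_order k) // (alternating_order l) // okl.
  by rewrite (neq k l.+1) ?orbF //= okl; case: (odd l).
rewrite cl mem_cycle_mul 1?coprime_sym //; first by rewrite (neq k l).
rewrite (alternating_order k) // (alternating_order l.+1) //=.
by case: (odd k) (odd l) nokl => [] [].
Qed.

(** * Subdivision of a closed walk *)

(** The walk u 0, u 0 * u 1, u 1, u 1 * u 2, u 2, and so on. *)
Definition subdivision (gT : finGroupType) (u : nat -> gT) (t : nat) : gT :=
  if odd t then u t./2 * u t./2.+1 else u t./2.

(** The terms u 0, ..., u m close up to a circuit through m different cyclic
    subgroups.  The end u m only has to generate the same subgroup as u 0, since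
    membership in cyclic subgroups is all that adjacency depends on. *)
Definition simple_circuit (gT : finGroupType) (u : nat -> gT) (m : nat) :=
  <[u m]> = <[u 0]> /\
  (forall k l, k < m -> l < m -> <[u k]> = <[u l]> -> k = l).

Lemma simple_circuit_eq (gT : finGroupType) (u : nat -> gT) m k l :
  0 < m -> simple_circuit u m -> k <= m -> l < m ->
  (<[u k]> == <[u l]>) = (k == l) || (k == m) && (l == 0).
Proof.
move=> m_gt0 [um u_inj]; rewrite leq_eqVlt => /predU1P[-> | ltkm] ltlm.
  rewrite um eqxx (gtn_eqF ltlm) /=.
  by apply/eqP/eqP => [/u_inj->|->].
rewrite (ltn_eqF ltkm) orbF.
by apply/eqP/eqP => [|-> //]; apply: u_inj.
Qed.

Lemma odd_ordS m (t : 'I_(m.*2)) : odd (ordS t) = ~~ odd t.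
Proof. by rewrite /= odd_mod ?odd_double. Qed.

(** A product lies in a cyclic subgroup exactly when both factors do, so each
    membership becomes a condition on which of the subgroups <[u k]> coincide,
    that is, on indices modulo m.  With m = 2 the two products
    u 0 * u 1 and u 1 * u 2 would generate the same subgroup, hence the bound
    on m. *)
Lemma mem_subdivision (gT : finGroupType) (u : nat -> gT) m (t s : 'I_(m.*2)) :
  alternating u -> 2 < m -> simple_circuit u m ->
  subdivision u t \in <[subdivision u s]> <->
  t = s \/ ~~ odd t /\ (s = ordS t \/ t = ordS s).
Proof.
move=> altu m_gt2 circ; have m_gt0 : 0 < m by exact: ltnW (ltnW m_gt2).
have ceq k l := simple_circuit_eq (k := k) (l := l) m_gt0 circ.
have ceqS k l : k < m -> l < m -> (<[u k]> == <[u l.+1]>) =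
    (l.+1 == k) || (l.+1 == m) && (k == 0).
  by move=> *; rewrite eq_sym ceq.
have ceqSS k l : k < m -> l < m -> (<[u k.+1]> == <[u l.+1]>) = (k == l).
  rewrite leq_eqVlt => /predU1P[ek | ltk] ltl.
    rewrite ek (proj1 circ) ceqS //; lia.
  by rewrite ceqS //; lia.
(* The successor modulo m.*2, written without modulo for the sake of lia. *)
have ordS_eq (a b : 'I_(m.*2)) :
    a = ordS b <-> (a = b.+1 :> nat) \/ (b.+1 = m.*2 /\ a = 0 :> nat).
  have [ltb lta] := (ltn_ord b, ltn_ord a).
  have -> : a = ordS b <-> a = b.+1 %% m.*2 :> nat.
    by split=> [-> // | e]; apply: val_inj.
  have [e|ne] := eqVneq b.+1 m.*2.
    by rewrite e modnn; lia.
  by rewrite modn_small; lia.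
have eq_ts : t = s <-> t = s :> nat.
  by split=> [-> // | e]; apply: val_inj.
rewrite eq_ts !ordS_eq /subdivision.
have [ltt lts] := (ltn_ord t, ltn_ord s).
have [tm sm] : t./2 < m /\ s./2 < m by lia.
have [ct cot _ _] := altu t./2.
(* When t is odd and s even, both factors of the product would have to generate
   <[u s./2]>, which the indices exclude. *)
case ot: (odd t); case os: (odd s); rewrite ?cycle_mul_mem //
  ?alternating_mem_mul ?alternating_mem //.
all: rewrite ?ceqSS ?ceqS ?ceq //; lia.
Qed.

(** * Induced cycles of the power graph *)

Lemma subg_exp_mem (gT : finGroupType) (G : {group gT}) (a b : gT) :
  a \in G -> b \in G ->
  (exists n, subg G a ^+ n = subg G b) <-> b \in <[a]>.
Proof.
move=> aG bG; split=> [[n e] | /cycleP[n ->]].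
  have := congr1 sgval e; rewrite -morphX // !subgK ?groupX // => <-.
  exact: mem_cycle.
by exists n; rewrite morphX.
Qed.

Lemma simple_circuit_not_chordal (gT : finGroupType) (G : {group gT})
    (u : nat -> gT) m :
  (forall k, u k \in G) -> alternating u -> 2 < m -> simple_circuit u m ->
  ~ chordal (Pow G).
Proof.
move=> uG altu m_gt2 circ chord.
have mem t s := mem_subdivision t s altu m_gt2 circ.
have dG t : subdivision u t \in G.
  by rewrite /subdivision; case: ifP => _; rewrite ?groupM.
pose c (t : 'I_(m.*2)) : vertex (Pow G) := subg G (subdivision u t).
have c_inj : injective c.
  move=> t s /(congr1 val); rewrite /= !subgK // => e.
  have /mem ts : subdivision u t \in <[subdivision u s]> by rewrite e cycle_id.
  have /mem st : subdivision u s \in <[subdivision u t]> by rewrite e cycle_id.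
  case: ts => // -[Nodd_t ts]; case: st => // -[Nodd_s _].
  by case: ts => es; move: Nodd_t Nodd_s; rewrite es odd_ordS => /negPf->.
apply: (chord m.*2 c); first by lia.
split=> // t s; rewrite /= /pow_adj !subg_exp_mem // !mem.
split=> [[nts] | st].
  have neq_ts : t <> s by move=> ets; apply: nts; rewrite ets.
  by case=> -[e | [_ e]]; [case: neq_ts | case: e; auto | case: neq_ts |].
have odd_ts : odd s = ~~ odd t.
  by case: st => ->; rewrite odd_ordS ?negbK.
split; first by move/c_inj=> ets; move: odd_ts; rewrite ets; case: (odd s).
case: (boolP (odd t)) => [ot | Not]; last by right; right.
by left; right; rewrite odd_ts ot; split=> //; case: st; auto.
Qed.

(** * The walk *)

Lemma first_repetition (T : finType) (V : nat -> T) :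
  exists i m, [/\ 0 < m, V (i + m) = V i &
    forall k l, k < m -> l < m -> V (i + k) = V (i + l) -> k = l].
Proof.
pose P j := [exists i : 'I_j, V i == V j].
have exP : exists j, P j.
  pose f (k : 'I_#|T|.+1) := V k.
  have /injectivePn[a [b neq_ab fab]] : ~~ injectiveb f.
    apply/negP => /injectiveP /leq_card; rewrite card_ord; lia.
  wlog lt_ab : a b neq_ab fab / a < b.
    have := neq_ab; rewrite -val_eqE neq_ltn => /orP[] lt_ab W; apply: W lt_ab => //.
    by rewrite eq_sym.
  by exists b; apply/existsP; exists (Ordinal lt_ab); apply/eqP.
have [j /existsP[i /eqP Vij] minj] := ex_minnP exP.
exists i, (j - i); have ltij := ltn_ord i; split=> [||k l ltk ltl].
- by rewrite subn_gt0.
- by rewrite subnKC // ltnW.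
wlog ltkl : k l ltk ltl / k < l => [W Vkl | Vkl].
  by have [lt|lt|//] := ltngtP k l; [exact: W | apply/esym/W].
suff /minj : P (i + l) by lia.
have ltikl : i + k < i + l by rewrite ltn_add2l.
by apply/existsP; exists (Ordinal ltikl); apply/eqP.
Qed.

Lemma centraliser_moves_cycle (gT : finGroupType) (G : {group gT}) (x y : gT) :
  x \in 'C_G[y] -> ~~ (<[x]> <| 'C_G[y]) ->
  exists g, [/\ g \in G, y ^ g = y & x ^ g \notin <[x]>].
Proof.
move=> xC; rewrite /normal cycle_subG xC /= => /subsetPn[g /setIP[gG /cent1P cyg]].
rewrite inE -cycleJ cycle_subG => nxg; exists g; split=> //.
by rewrite conjgE -cyg mulKg.
Qed.

(** The k-th term is the conjugate of z k, which is x or y, by a word w k in g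
    and h.  Passing from w k to w k.+1 puts on the left the one of g, h that
    fixes z k.+1: so w k and w k.+1 conjugate z k.+1 to the same element, which
    makes v k and v k.+1 simultaneous conjugates of x and y.  The same letter
    moves <[z k]> = <[z k.+2]>, so the walk does not turn back. *)
Lemma nonbacktracking_walk (gT : finGroupType) (G : {group gT}) (x y g h : gT) :
  x \in G -> y \in G -> g \in G -> h \in G ->
  coprime #[x] #[y] -> commute x y ->
  y ^ g = y -> x ^ h = x -> x ^ g \notin <[x]> -> y ^ h \notin <[y]> ->
  exists v : nat -> gT, [/\ forall k, v k \in G, alternating v &
    forall k, <[v k]> <> <[v k.+2]>].
Proof.
move=> xG yG gG hG co cxy yg xh nxg nyh.
pose z k := if odd k then y else x.
pose s k := if odd k then h else g.
pose fix w k := if k is k'.+1 then s k' * w k' else 1.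
have zG k : z k \in G by rewrite /z; case: ifP.
have wG k : w k \in G.
  by elim: k => //= k IH; rewrite groupM // /s; case: ifP.
have vS k : z k.+1 ^ w k.+1 = z k.+1 ^ w k.
  by rewrite /= conjgM; congr (_ ^ _); rewrite /z /s /=; case: (odd k).
have zz k : z k.+2 = z k by rewrite /z /= negbK.
exists (fun k => z k ^ w k); split=> [k | k | k].
- exact: groupJ.
- split.
  + rewrite vS /commute -!conjMg; congr (_ ^ _).
    by rewrite /z /=; case: (odd k).
  + by rewrite !orderJ /z /=; case: (odd k); rewrite //= coprime_sym.
  + rewrite orderJ order_gt1 /z; case: (odd k).
      by apply: contraNneq nyh => ->; rewrite conj1g group1.
    by apply: contraNneq nxg => ->; rewrite conj1g group1.
  + by rewrite !orderJ zz.
rewrite vS zz /= conjgM !cycleJ => /(can_inj (conjsgK (w k))).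
move=> e; have: z k ^ s k \in <[z k]>
  by rewrite -cycle_subG cycleJ -e.
by rewrite /z /s; case: (odd k); apply/negP.
Qed.

Theorem lemma3p20 (gT : finGroupType) (G : {group gT}) (x y : gT)
  (xG : x \in G) (yG : y \in G)
  (co_xy : coprime #[x] #[y])
  (cxy : x * y = y * x)
  (nnx : ~~ (<[x]> <| 'C_G[y]))
  (nny : ~~ (<[y]> <| 'C_G[x])) :
  ~ chordal (Pow G).
Proof.
have [|g [gG yg nxg]] := centraliser_moves_cycle _ nnx.
  by rewrite inE xG; apply/cent1P.
have [|h [hG xh nyh]] := centraliser_moves_cycle _ nny.
  by rewrite inE yG; apply/cent1P.
have [v [vG altv nbv]] :=
  nonbacktracking_walk xG yG gG hG co_xy cxy yg xh nxg nyh.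
have [i [m [m_gt0 vim v_inj]]] := first_repetition (fun k => <[v k]>).
apply: (@simple_circuit_not_chordal _ G (fun k => v (i + k)) m) => //.
- exact: alternating_shift.
(* A return after one step is excluded by coprimality of the orders, a return
   after two steps by the absence of backtracking. *)
- case: m m_gt0 vim {v_inj} => [|[|[|m]]] // _ vim.
    have [] : odd (i + 1) <> odd i by rewrite addn1 /=; case: (odd i).
    by apply: (alternating_dvd_odd altv); rewrite !orderE vim.
  by case: (nbv i); rewrite -vim addn2.
- by split; rewrite ?addn0.
Qed.
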